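(* Let $q>3$ be a power of an odd prime and let $X$ be a primitive quandle with $\operatorname{Inn}(X)=\mathrm{PGL}(2,q)$ (as abstract groups, up to isomorphism). Then either (i) $q\equiv 1\pmod 4$, $|X|=q(q-1)/2$ and $X\cong\operatorname{Conj}(\mathrm{PGL}(2,q),\mathcal{C}_6')$, where $\mathcal{C}_6'$ is the conjugacy class in $\mathrm{PGL}(2,q)$ of the image of $\begin{pmatrix} 0&\Delta\\1&0\end{pmatrix}$ and $\Delta\in\mathbb{F}_q$ is a fixed nonsquare; or (ii) $q\equiv 3\pmod 4$, $|X|=q(q+1)/2$ and $X\cong\operatorname{Conj}(\mathrm{PGL}(2,q),\mathcal{C}_4')$, where $\mathcal{C}_4'$ is the conjugacy class in $\mathrm{PGL}(2,q)$ of the image of $\begin{pmatrix} -1&0\\0&1\end{pmatrix}$.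
   Context: A quandle is a set $X$ with a binary operation $\triangleright$ such that (1) $x\triangleright x=x$ for all $x$; (2) for every $x\in X$ the right translation $R_x:X\to X$, $R_x(y)=y\triangleright x$, is a bijection; (3) $(x\triangleright y)\triangleright z=(x\triangleright z)\triangleright(y\triangleright z)$ for all $x,y,z$. $\operatorname{Inn}(X)=\langle R_x:x\in X\rangle\le\operatorname{Sym}(X)$. The quandle $X$ is primitive if the natural action of $\operatorname{Inn}(X)$ on $X$ is a primitive group action. For a group $G$ and a subset $C\subseteq G$ closed under conjugation, $\operatorname{Conj}(G,C)$ is the quandle on $C$ with operation $x\triangleright y=yxy^{-1}$. $\mathrm{PGL}(2,q)=\mathrm{GL}(2,q)/\{\lambda I:\lambda\in\mathbb{F}_q^*\}$. *)

(* Defs.v *)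
From mathcomp Require Import all_boot all_order all_algebra all_fingroup.

Set Implicit Arguments.
Unset Strict Implicit.
Unset Printing Implicit Defensive.

Import GRing.Theory.

Local Open Scope group_scope.

Record quandle := Quandle {
  qcarrier :> Type;
  qop : qcarrier -> qcarrier -> qcarrier;
  qop_idem : forall x, qop x x = x;
  qop_bij : forall x, bijective (fun y => qop y x);
  qop_distr : forall x y z, qop (qop x y) z = qop (qop x z) (qop y z) }.

Definition rtrans (X : quandle) (x : X) : X -> X := fun y => qop y x.

(* The carrier is an arbitrary type, so a subgroup of Sym(X) is a predicate on
   functions X -> X (with composition as product), considered up to pointwise
   equality =1. *)
Inductive Inn (X : quandle) : (X -> X) -> Prop :=
| Inn_rtrans x : Inn (rtrans x)
| Inn_id : Inn id
| Inn_comp f g : Inn f -> Inn g -> Inn (f \o g)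
| Inn_inv f g : Inn f -> cancel f g -> cancel g f -> Inn g.

Definition transitive_action (T : Type) (H : (T -> T) -> Prop) :=
  forall x y : T, exists2 f, H f & f x = y.

Definition equivalence_relation (T : Type) (E : T -> T -> Prop) :=
  [/\ forall x, E x x, forall x y, E x y -> E y x
    & forall x y z, E x y -> E y z -> E x z].

Definition invariant_relation (T : Type) (H : (T -> T) -> Prop)
    (E : T -> T -> Prop) :=
  forall f, H f -> forall x y, E x y -> E (f x) (f y).

(* Invariant partitions are presented by their equivalence relations. *)
Definition primitive_action (T : Type) (H : (T -> T) -> Prop) :=
  transitive_action H /\
  forall E : T -> T -> Prop, equivalence_relation E -> invariant_relation H E ->
    (forall x y, E x y -> x = y) \/ (forall x y, E x y).

Definition primitive_quandle (X : quandle) := primitive_action (@Inn X).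

Definition isog_perm (gT : finGroupType) (G : {group gT})
    (T : Type) (H : (T -> T) -> Prop) :=
  exists phi : gT -> T -> T,
    [/\ forall g, g \in G -> H (phi g),
        {in G &, forall g h, phi (g * h) =1 phi g \o phi h},
        {in G &, forall g h, phi g =1 phi h -> g = h}
      & forall f, H f -> exists2 g, g \in G & phi g =1 f].

Definition has_card (T : Type) (n : nat) := exists f : 'I_n -> T, bijective f.

Definition quandle_iso (X Y : quandle) :=
  exists f : X -> Y,
    bijective f /\ forall x y, f (qop x y) = qop (f x) (f y).

Section Conj.

Variables (gT : finGroupType) (G : {group gT}) (C : {set gT}).
Hypotheses (sCG : C \subset G) (nCG : G \subset 'N(C)).

Lemma conj_mem (x y : gT) : x \in C -> y \in C -> y * x * y^-1 \in C.
Proof.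
move=> Cx Cy; have Ny : y \in 'N(C) by apply: (subsetP nCG); apply: (subsetP sCG).
by have := memJ_norm x (groupVr Ny); rewrite /conjg invgK mulgA => ->.
Qed.

Lemma conj_memV (x y : gT) : x \in C -> y \in C -> y^-1 * x * y \in C.
Proof.
move=> Cx Cy; have Ny : y \in 'N(C) by apply: (subsetP nCG); apply: (subsetP sCG).
by have := memJ_norm x Ny; rewrite /conjg mulgA => ->.
Qed.

Definition conj_op (x y : {x : gT | x \in C}) : {x : gT | x \in C} :=
  exist _ (val y * val x * (val y)^-1) (conj_mem (valP x) (valP y)).

Lemma conj_idem x : conj_op x x = x.
Proof. by apply: val_inj; rewrite /= mulgK. Qed.

Lemma conj_bij x : bijective (fun y => conj_op y x).
Proof.
exists (fun y : {x : gT | x \in C} => exist (fun z => z \in C)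
  ((val x)^-1 * val y * val x) (conj_memV (valP y) (valP x))) => y;
  by apply: val_inj; rewrite /= !mulgA ?mulVg ?mulgV mul1g ?mulgKV ?mulgK.
Qed.

Lemma conj_distr x y z :
  conj_op (conj_op x y) z = conj_op (conj_op x z) (conj_op y z).
Proof. by apply: val_inj; rewrite /= !invMg !invgK !mulgA !mulgKV. Qed.

Definition Conj : quandle := Quandle conj_idem conj_bij conj_distr.

End Conj.

Definition Conj_class (gT : finGroupType) (G : {group gT}) (g : gT)
    (Gg : g \in G) : quandle :=
  Conj (class_subG Gg (subxx G)) (class_norm g G).

Section PGL2.

Variable F : finFieldType.

Definition scalarGL2_set : {set {'GL_2[F]}} :=
  [set g : {'GL_2[F]} | is_scalar_mx (GLval g)].

Lemma scalarGL2_group_set : group_set scalarGL2_set.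
Proof.
apply/group_setP; split=> [|g h]; rewrite !inE; first exact: scalar_mx_is_scalar.
move=> /is_scalar_mxP[a ga] /is_scalar_mxP[b hb].
by rewrite GL_MxE ga hb -scalar_mxM scalar_mx_is_scalar.
Qed.

Canonical scalarGL2 := Group scalarGL2_group_set.

Definition PGL2 := ('GL_2[F] / scalarGL2)%G.

(* coset and / only have their usual meaning inside the normaliser. *)
Lemma GL2_norm_scalar : 'GL_2[F] \subset 'N(scalarGL2).
Proof.
apply/subsetP=> g _; rewrite inE; apply/subsetP=> _ /imsetP[h + ->].
rewrite inE /= => hs; suff -> : h ^ g = h by rewrite inE.
apply/conjg_fixP/commgP/val_inj; case/is_scalar_mxP: hs => a ha.
have: GLval (h * g) = GLval (g * h) by rewrite !GL_MxE ha scalar_mxC.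
exact.
Qed.

Lemma coset_PGL2 (g : {'GL_2[F]}) : coset scalarGL2 g \in PGL2.
Proof. by rewrite mem_quotient ?inE. Qed.

Local Open Scope ring_scope.

Definition mx2 (a b c d : F) : 'M[F]_2 :=
  \matrix_(i < 2, j < 2)
    if i == 0 then (if j == 0 then a else b) else (if j == 0 then c else d).

Lemma mx2_unit a b c d : a * d - b * c != 0 -> mx2 a b c d \is a GRing.unit.
Proof.
suff det22 : \det (mx2 a b c d) = a * d - b * c.
  by move=> nz; rewrite -[_ \is a _]/(_ \in unitmx) unitmxE unitfE det22.
rewrite (expand_det_row _ ord0) !big_ord_recl big_ord0 addr0 /cofactor.
by rewrite !det_mx11 !mxE /= expr0 expr1 mul1r mulN1r mulrN.
Qed.

Definition GL2 a b c d (nz : a * d - b * c != 0) : {'GL_2[F]} :=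
  FinRing.unit _ (mx2_unit nz).

Definition PGL2_class a b c d (nz : a * d - b * c != 0) : quandle :=
  Conj_class (coset_PGL2 (GL2 nz)).

Definition nonsquare (D : F) := forall x : F, x ^+ 2 <> D.

Lemma C6_det (D : F) : nonsquare D -> 0 * 0 - D * 1 != 0.
Proof.
move=> nsD; rewrite mul0r mulr1 sub0r oppr_eq0; apply/eqP=> D0.
by case: (nsD 0); rewrite D0 expr0n.
Qed.

Lemma C4_det : (-1) * 1 - 0 * 0 != 0 :> F.
Proof. by rewrite mul0r subr0 mulr1 oppr_eq0 oner_eq0. Qed.

Definition Conj_C6 (D : F) (nsD : nonsquare D) : quandle :=
  @PGL2_class 0 D 1 0 (C6_det nsD).

Definition Conj_C4 : quandle := @PGL2_class (-1) 0 0 1 C4_det.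

End PGL2.

(* Main.v *)
Require Import Defs.
From mathcomp Require Import all_boot all_order all_algebra all_fingroup.
From mathcomp Require Import cyclic finfield ring zify.
From mathcomp Require boolp.

(** Write [c x] for the element of G = Inn(X) that is the translation R_x. The
map c is equivariant from X to G acting on itself by conjugation, its image
generates G. Its fibres are blocks, hence points if X is primitive and G is not
abelian, and then X is Conj(G, C) for a conjugacy class C that generates G.

The same argument applies to the coarser invariant relation c x = c y or
c x = c y ^-1 ([c_eq_or_inv]). If it were total, all the c x would be powers of
one element and G would be abelian; so it is equality, and therefore a class C
that is closed under inversion consists of involutions. This replaces an
inspection of the maximal subgroups of G: a class qualifies only if its
elements are not conjugate to a different inverse.

In PGL(2, F) every element is conjugate to its inverse ([PGL2_real]), because
two non-scalar 2 x 2 matrices with the same trace and determinant are conjugate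
([GL2_conj], by reduction to a companion matrix), and the inverse of M is, up to
a scalar, its adjugate, which has the trace and the determinant of M. So C is a
class of involutions, and these are the images of matrices of trace 0
([tr_of_involution]). As C generates, its determinant is not a square
([all_square_of_generation]).

A traceless M is determined up to conjugacy and scaling by the class of
D = - det M modulo squares. Whether -1 is a square decides between q = 1 and
q = 3 modulo 4; in the former case D is a nonsquare and C is the class of
[0, Delta; 1, 0], in the latter D is a square and C is the class of
diag(-1, 1). Finally #|C| is half the number of solutions of a^2 + bc = D, each
element of C having exactly two lifts of determinant - D. *)

Set Implicit Arguments.
Unset Strict Implicit.
Unset Printing Implicit Defensive.

Import GRing.Theory.

Local Open Scope group_scope.

(** * Primitive quandles and conjugacy classes *)

Lemma Inn_morph (X : quandle) (f : X -> X) :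
  Inn f -> forall x y, f (qop x y) = qop (f x) (f y).
Proof.
elim=> {f} [z x y|//|f g _ IHf _ IHg x y|f g _ IHf fK gK x y].
- exact: qop_distr.
- by rewrite /= IHg IHf.
- by rewrite -{1}(gK x) -{1}(gK y) -IHf fK.
Qed.

Lemma bijective_of_inj_surj (T U : Type) (f : T -> U) :
  injective f -> (forall u, exists t, f t = u) -> bijective f.
Proof. by move=> injf /boolp.choice[g gK]; exists g => // t; apply: injf. Qed.

Section QuandleInGroup.

Variables (gT : finGroupType) (G : {group gT}) (X : quandle).
Variable phi : gT -> X -> X.
Hypothesis Inn_phi : forall g, g \in G -> Inn (phi g).
Hypothesis phiM : {in G &, forall g h, phi (g * h) =1 phi g \o phi h}.
Hypothesis phi_inj : {in G &, forall g h, phi g =1 phi h -> g = h}.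
Hypothesis phi_surj : forall f, Inn f -> exists2 g, g \in G & phi g =1 f.

Lemma phi1 : phi 1 =1 id.
Proof.
have [g Gg phig] := phi_surj (@Inn_id X).
suff <- : g = 1 by [].
apply: (mulgI g); rewrite mulg1; apply: phi_inj; rewrite ?groupM // => x.
by rewrite phiM //= !phig.
Qed.

(** In the rest of the section c is the map x |-> R_x, read inside G. *)
Variable c : X -> gT.
Hypothesis Gc : forall x, c x \in G.
Hypothesis phi_c : forall x, phi (c x) =1 rtrans x.

(** Inner maps are quandle morphisms, so conjugating R_x by f gives R_(f x). *)
Lemma c_equivariant g x : g \in G -> c (phi g x) = g * c x * g^-1.
Proof.
move=> Gg; apply: (mulIg g); rewrite mulgKV.
apply: phi_inj; rewrite ?groupM // => y.
by rewrite !phiM //= !phi_c /rtrans (Inn_morph (Inn_phi Gg)).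
Qed.

Lemma c_qop x y : c (qop x y) = c y * c x * (c y)^-1.
Proof. by rewrite -c_equivariant // phi_c. Qed.

Lemma c_generates (H : {group gT}) : (forall x, c x \in H) -> G \subset H.
Proof.
move=> Hc.
suff InnH f : Inn f -> exists2 h, h \in G :&: H & phi h =1 f.
  apply/subsetP=> g Gg; have [h /setIP[Gh Hh] phih] := InnH _ (Inn_phi Gg).
  by rewrite -(phi_inj Gh Gg phih).
elim=> {f} [x||f g _ [h GHh phih] _ [k GHk phik]|f g _ [h GHh phih] fK gK].
- by exists (c x) => //; rewrite inE Gc Hc.
- by exists 1 => //; apply: phi1.
- exists (h * k) => [|x]; first exact: groupM.
  have [[Gh _] [Gk _]] := (setIP GHh, setIP GHk).
  by rewrite phiM //= phik phih.
- exists h^-1 => [|y]; first by rewrite groupV.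
  have [Gh _] := setIP GHh.
  rewrite -{1}(gK y) -phih -[LHS]/((phi h^-1 \o phi h) (g y)).
  by rewrite -phiM ?groupV // mulVg phi1.
Qed.

Hypothesis X_prim : primitive_quandle X.
Hypothesis nabG : ~~ abelian G.

(** An empty quandle has a trivial group of inner maps. *)
Lemma X_inhabited : exists x0 : X, True.
Proof.
apply: boolp.contrapT => X0; case/negP: nabG.
have H1 x : c x \in 1%G by case: X0; exists x.
exact: abelianS (c_generates H1) (abelian1 _).
Qed.

(** The relation in the hypothesis is an invariant equivalence. By primitivity
it is equality unless it is total, and then every R_x lies in the cyclic group
of one of them, which makes G abelian. *)
Lemma c_eq_or_inv x y : c x = c y \/ c x = (c y)^-1 -> x = y.
Proof.
have [||E_eq|E_all] := X_prim.2 (fun x y => c x = c y \/ c x = (c y)^-1).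
- split=> [a|a b [->|->]|a b d [->|->] [->|->]]; rewrite ?invgK;
    by [left | right].
- move=> f /phi_surj[g Gg phig] a b; rewrite -!phig !c_equivariant //.
  by case=> ->; [left | right]; rewrite ?invMg ?invgK ?mulgA.
- exact: E_eq.
- case/negP: nabG; apply: abelianS (cycle_abelian (c x)).
  apply: c_generates => z.
  by case: (E_all z x) => ->; rewrite ?groupV cycle_id.
Qed.

Lemma c_inj : injective c.
Proof. by move=> x y cxy; apply: c_eq_or_inv; left. Qed.

Lemma c_in_class x y : c y \in c x ^: G.
Proof.
have [f /phi_surj[g Gg phig] <-] := X_prim.1 x y.
have -> : c (f x) = c x ^ g^-1.
  by rewrite -phig c_equivariant // conjgE invgK mulgA.
by rewrite memJ_class ?groupV.
Qed.

Lemma class_in_c x g : g \in c x ^: G -> exists y, c y = g.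
Proof.
case/imsetP=> h Gh ->; exists (phi h^-1 x).
by rewrite c_equivariant ?groupV // invgK conjgE mulgA.
Qed.

Lemma c_iso (D : {set gT}) (sDG : D \subset G) (nDG : G \subset 'N(D)) x :
  c x ^: G = D -> quandle_iso X (Conj sDG nDG).
Proof.
move=> defD; have Dc y : c y \in D by rewrite -defD c_in_class.
exists (fun y => exist (fun g => g \in D) (c y) (Dc y)); split=> [|y z].
  apply: bijective_of_inj_surj => [y z [/c_inj]// | [g Dg]].
  have [|y cy] := @class_in_c x g; first by rewrite defD.
  by exists y; apply: val_inj.
by apply: val_inj; rewrite /= c_qop.
Qed.

Lemma c_card x : has_card X #|c x ^: G|.
Proof.
have /boolp.choice[f fK] (i : 'I_#|c x ^: G|) : exists y, c y = enum_val i.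
  exact: class_in_c (enum_valP i).
exists f; apply: bijective_of_inj_surj => [i j fij | y].
  by apply: enum_val_inj; rewrite -!fK fij.
exists (enum_rank_in (c_in_class x x) (c y)); apply: c_inj.
by rewrite fK enum_rankK_in ?c_in_class.
Qed.

Lemma conj_of_translation_map :
  exists2 g, g \in G &
    [/\ has_card X #|g ^: G|, G \subset <<g ^: G>>,
        g^-1 \in g ^: G -> g^-1 = g
      & forall h (Gh : h \in G), h \in g ^: G -> quandle_iso X (Conj_class Gh)].
Proof.
have [x _] := X_inhabited.
exists (c x) => //; split=> [||cVx|h Gh /class_eqP hx].
- exact: c_card.
- by apply: c_generates => y; rewrite mem_gen // c_in_class.
- have [y cy] := class_in_c cVx.
  by rewrite -cy; congr c; apply: c_eq_or_inv; right.
- exact: c_iso (esym hx).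
Qed.

End QuandleInGroup.

(** Primitivity says that the centraliser of g is maximal in G. The third
conclusion is the consequence used below: if g is conjugate to its inverse, the
centraliser of g lies in the stabiliser of {g, g^-1}, properly so unless g is an
involution. *)
Theorem primitive_quandle_conj (gT : finGroupType) (G : {group gT})
    (X : quandle) :
  primitive_quandle X -> isog_perm G (@Inn X) -> ~~ abelian G ->
  exists2 g, g \in G &
    [/\ has_card X #|g ^: G|, G \subset <<g ^: G>>,
        g^-1 \in g ^: G -> g^-1 = g
      & forall h (Gh : h \in G), h \in g ^: G -> quandle_iso X (Conj_class Gh)].
Proof.
move=> X_prim [phi [Inn_phi phiM phi_inj phi_surj]] nabG.
have /boolp.choice[c /all_and2[Gc phi_c]] (x : X) :
    exists g, g \in G /\ phi g =1 rtrans x.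
  by have [g] := phi_surj _ (Inn_rtrans x); exists g.
exact: (conj_of_translation_map Inn_phi phiM phi_inj phi_surj Gc phi_c).
Qed.

(** * Matrices of order 2 *)

Section Matrix2.

Variable F : finFieldType.
Implicit Types A B P : 'M[F]_2.
Local Open Scope ring_scope.

Lemma ord2P (i : 'I_2) : (i = 0) \/ (i = 1).
Proof. by case: i => -[|[|//]] lt_i; [left | right]; apply: val_inj. Qed.

Lemma eq_mx2 A B :
  A 0 0 = B 0 0 -> A 0 1 = B 0 1 -> A 1 0 = B 1 0 -> A 1 1 = B 1 1 -> A = B.
Proof.
move=> e00 e01 e10 e11; apply/matrixP=> i j.
by case: (ord2P i) => ->; case: (ord2P j) => ->.
Qed.

Lemma mulmx2E A B i j : (A *m B) i j = A i 0 * B 0 j + A i 1 * B 1 j.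
Proof.
rewrite !mxE !big_ord_recl big_ord0 addr0.
by have -> : lift ord0 ord0 = 1 :> 'I_2 by apply: val_inj.
Qed.

Lemma tr_mx2 A : \tr A = A 0 0 + A 1 1.
Proof.
rewrite /mxtrace !big_ord_recl big_ord0 addr0.
by have -> : lift ord0 ord0 = 1 :> 'I_2 by apply: val_inj.
Qed.

Lemma det_mx2 A : \det A = A 0 0 * A 1 1 - A 0 1 * A 1 0.
Proof.
rewrite (expand_det_row _ 0) !big_ord_recl big_ord0 addr0 /cofactor.
have -> : lift ord0 ord0 = 1 :> 'I_2 by apply: val_inj.
rewrite !det_mx11 !mxE /= expr0 expr1 mul1r mulN1r mulrN.
have -> : lift 0 0 = 1 :> 'I_2 by apply: val_inj.
by have -> : lift 1 0 = 0 :> 'I_2 by apply: val_inj.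
Qed.

Lemma scalar_mx2P A :
  reflect [/\ A 0 1 = 0, A 1 0 = 0 & A 0 0 = A 1 1] (is_scalar_mx A).
Proof.
apply: (iffP is_scalar_mxP) => [[a ->] | [A01 A10 A00]]; first by rewrite !mxE.
by exists (A 0 0); apply: eq_mx2; rewrite !mxE /= ?mulr1n ?mulr0n.
Qed.

(** The rows of P are a vector v and v A; they are independent for one of
v = (1, 0), (0, 1), (1, 1), since a matrix having all three as eigenvectors is
scalar. In the basis v, v A the matrix is a companion matrix by
Cayley-Hamilton. *)
Lemma companion_mx2 A : ~~ is_scalar_mx A ->
  exists2 P : 'M[F]_2, \det P != 0
    & P *m A = mx2 0 1 (- \det A) (\tr A) *m P.
Proof.
move=> nsA.
pose P x y := mx2 x y (x * A 0 0 + y * A 1 0) (x * A 0 1 + y * A 1 1).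
have PA x y : P x y *m A = mx2 0 1 (- \det A) (\tr A) *m P x y.
  by apply: eq_mx2; rewrite !mulmx2E /P !mxE /= ?tr_mx2 ?det_mx2; ring.
have detP x y : \det (P x y)
    = x * (x * A 0 1 + y * A 1 1) - y * (x * A 0 0 + y * A 1 0).
  by rewrite det_mx2 !mxE.
have [A01|nz] := eqVneq (A 0 1) 0; last first.
  by exists (P 1 0); rewrite // detP (_ : _ - _ = A 0 1) //; ring.
have [A10|nz] := eqVneq (A 1 0) 0; last first.
  by exists (P 0 1); rewrite // detP (_ : _ - _ = - A 1 0) ?oppr_eq0 //; ring.
exists (P 1 1) => //.
rewrite detP A01 A10 (_ : _ - _ = A 1 1 - A 0 0); last by ring.
by apply: contraNneq nsA => /subr0_eq A11; apply/scalar_mx2P.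
Qed.

End Matrix2.

(** * Conjugacy in GL(2, F) and PGL(2, F) *)

Section GL2.

Variable F : finFieldType.
Implicit Types (M N : {'GL_2[F]}) (a : F).
Local Open Scope ring_scope.

Lemma GL2_of_det (A : 'M[F]_2) : \det A != 0 -> exists M, GLval M = A.
Proof.
move=> nzA; have uA : A \is a GRing.unit.
  by rewrite -[_ \is a _]/(_ \in unitmx) unitmxE unitfE.
by exists (FinRing.unit _ uA).
Qed.

Lemma GL2_conj M N :
  ~~ is_scalar_mx (GLval M) -> ~~ is_scalar_mx (GLval N) ->
  \tr (GLval M) = \tr (GLval N) -> \det (GLval M) = \det (GLval N) ->
  N \in (M ^: 'GL_2[F])%g.
Proof.
have norm_form (L : {'GL_2[F]}) : ~~ is_scalar_mx (GLval L) ->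
    exists g,
      GLval (g * L * g^-1)%g = mx2 0 1 (- \det (GLval L)) (\tr (GLval L)).
  case/companion_mx2=> P /GL2_of_det[g <-] gL; exists g.
  by rewrite !GL_MxE GL_VxE gL mulmxK ?GL_unitmx.
move=> /norm_form[g gM] /norm_form[h hN] eq_tr eq_det.
have eq_gh : (g * M * g^-1 = h * N * h^-1)%g.
  by apply/val_inj; rewrite [LHS]gM [RHS]hN eq_tr eq_det.
apply/imsetP; exists (g^-1 * h)%g; first by rewrite inE.
apply: (mulgI h); apply: (mulIg h^-1%g).
by rewrite -eq_gh conjgE invMg invgK !mulgA mulgV mul1g mulgK.
Qed.

Lemma scaleGL2 a M : a != 0 -> exists N, GLval N = a *: GLval M.
Proof.
move=> nza; apply: GL2_of_det; rewrite detZ mulf_neq0 ?expf_neq0 //.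
exact: (GL_det M).
Qed.

Local Notation pi := (coset (scalarGL2 F)).

Lemma mem_norm_scalar M : M \in 'N(scalarGL2 F)%g.
Proof. by apply: (subsetP (GL2_norm_scalar F)); rewrite inE. Qed.

Lemma coset_eqP M N :
  reflect (exists2 a, a != 0 & GLval M = a *: GLval N) (pi M == pi N).
Proof.
apply: (iffP eqP) => [/kercoset_rcoset[]|[a nza MaN]].
- exact: mem_norm_scalar.
- exact: mem_norm_scalar.
- move=> z; rewrite inE => /is_scalar_mxP[a za] ->; exists a.
    have := GL_det z; rewrite za det_scalar.
    by apply: contraNneq => ->; rewrite expr0n.
  by rewrite GL_MxE za mul_scalar_mx.
have [z za] : exists z : {'GL_2[F]}, GLval z = a%:M.
  by apply: GL2_of_det; rewrite det_scalar expf_neq0.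
have -> : M = (z * N)%g.
  by apply: val_inj; rewrite [LHS]MaN [RHS]GL_MxE za mul_scalar_mx.
by rewrite coset_kerl // inE za scalar_mx_is_scalar.
Qed.

Lemma scalar_mxZ a (A : 'M[F]_2) :
  a != 0 -> is_scalar_mx (a *: A) = is_scalar_mx A.
Proof.
move=> nza; apply/is_scalar_mxP/is_scalar_mxP => [[b Ab] | [b ->]].
  exists (a^-1 * b).
  by rewrite scalar_mxM -Ab mul_scalar_mx scalerA mulVf ?scale1r.
by exists (a * b); rewrite scale_scalar_mx.
Qed.

Lemma PGL2_conj a M N : a != 0 ->
    ~~ is_scalar_mx (GLval M) -> ~~ is_scalar_mx (GLval N) ->
    \tr (GLval N) = a * \tr (GLval M) ->
    \det (GLval N) = a ^+ 2 * \det (GLval M) ->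
  pi N \in (pi M ^: PGL2 F)%g.
Proof.
move=> nza nsM nsN trN detN; have [L LaM] := scaleGL2 M nza.
have -> : pi M = pi L by apply/esym/eqP/coset_eqP; exists a.
have /imsetP[g _ ->] : N \in (L ^: 'GL_2[F])%g.
  by apply: GL2_conj; rewrite // LaM ?scalar_mxZ ?mxtraceZ ?detZ.
rewrite morphJ ?mem_norm_scalar //; apply/imsetP; exists (pi g) => //.
by rewrite mem_quotient ?inE.
Qed.

Lemma invGL2E M : GLval M^-1%g =
  (\det (GLval M))^-1 *:
    mx2 (GLval M 1 1) (- GLval M 0 1) (- GLval M 1 0) (GLval M 0 0).
Proof.
have nzd := GL_det M; rewrite GL_VxE.
set B := _ *: _; suff AB : GLval M *m B = 1%:M.
  by rewrite -[LHS]mulmx1 -AB mulKmx ?GL_unitmx.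
move: nzd; rewrite /B det_mx2 => nzd.
by apply: eq_mx2; rewrite mulmx2E !mxE /=; field; exact: nzd.
Qed.

(** A scalar multiple of the inverse of M is the adjugate of M, which has the
same trace and determinant as M. *)
Lemma PGL2_real M : (pi M)^-1%g \in (pi M ^: PGL2 F)%g.
Proof.
have [sM|nsM] := boolP (is_scalar_mx (GLval M)).
  by rewrite coset_id ?inE // invg1 class_refl.
have nzd : \det (GLval M) != 0 := GL_det M.
rewrite -morphV ?mem_norm_scalar //.
apply: (@PGL2_conj (\det (GLval M))^-1) => //.
- by rewrite invr_eq0.
- have := groupV (scalarGL2 F) M; rewrite !inE => ->; exact: nsM.
- by rewrite invGL2E mxtraceZ !tr_mx2 !mxE /= addrC.
- by rewrite GL_VxE det_inv; field; exact: nzd.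
Qed.

(** An involution is a non-scalar M proportional to its adjugate. If b is the
ratio, the quantities M 0 1, M 1 0 and M 0 0 - M 1 1 all equal - b times themselves;
one of them is nonzero, so b = -1, which reads M 0 0 = - M 1 1. *)
Lemma tr_of_involution M :
  (pi M)^-1%g = pi M -> pi M != 1%g -> \tr (GLval M) = 0.
Proof.
move=> /esym/eqP; rewrite -morphV ?mem_norm_scalar // => /coset_eqP[a _].
rewrite invGL2E scalerA; set b := _ * _ => M_E nt.
have M00 : GLval M 0 0 = b * GLval M 1 1 by rewrite {1}M_E !mxE.
have M01 : GLval M 0 1 = b * - GLval M 0 1 by rewrite {1}M_E !mxE.
have M10 : GLval M 1 0 = b * - GLval M 1 0 by rewrite {1}M_E !mxE.
have M11 : GLval M 1 1 = b * GLval M 0 0 by rewrite {1}M_E !mxE.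
have bN1 x : x = b * - x -> b = -1 \/ x = 0.
  move=> xE; have [->|nzx] := eqVneq x 0; [by right | left].
  by apply: (mulIf nzx); rewrite mulN1r {2}xE mulrN opprK.
have tr0 : b = -1 -> \tr (GLval M) = 0.
  by rewrite tr_mx2 M00 => ->; rewrite mulN1r addNr.
case: (bN1 _ M01) => [/tr0 // | M01_0]; case: (bN1 _ M10) => [/tr0 // | M10_0].
have [|/tr0 // | /subr0_eq M00_11] := bN1 (GLval M 0 0 - GLval M 1 1).
  by rewrite opprB mulrBr -M00 -M11.
by case/eqP: nt; apply: coset_id; rewrite inE; apply/scalar_mx2P.
Qed.

Lemma PGL2_nonabelian : ~~ abelian (PGL2 F).
Proof.
have [A AE] : exists A : {'GL_2[F]}, GLval A = mx2 1 1 0 1.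
  by apply: GL2_of_det; rewrite det_mx2 !mxE /= mulr0 subr0 mulr1 oner_neq0.
have [B BE] : exists B : {'GL_2[F]}, GLval B = mx2 1 0 1 1.
  by apply: GL2_of_det; rewrite det_mx2 !mxE /= mul0r subr0 mulr1 oner_neq0.
apply/negP => /centsP/(_ _ (coset_PGL2 A) _ (coset_PGL2 B))/eqP.
rewrite -!morphM ?mem_norm_scalar // => /coset_eqP[a _].
rewrite !GL_MxE AE BE => /matrixP ABE.
have := ABE 0 0; rewrite [RHS]mxE !mulmx2E !mxE /= => ABE00.
have := ABE 0 1; rewrite [RHS]mxE !mulmx2E !mxE /=; move: ABE00 => /[swap].
rewrite !(mulr1, mul1r, mulr0, mul0r, addr0, add0r) => <- /eqP.
by rewrite -subr_eq0 addrK oner_eq0.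
Qed.

Definition square_det_set : {set {'GL_2[F]}} :=
  [set M | [exists s, \det (GLval M) == s ^+ 2]].

Lemma square_det_group_set : group_set square_det_set.
Proof.
apply/group_setP; split=> [|M N]; rewrite !inE.
  by apply/existsP; exists 1; rewrite det1 expr1n.
move=> /existsP[s /eqP sM] /existsP[t /eqP tN].
by apply/existsP; exists (s * t); rewrite GL_MxE det_mulmx sM tN exprMn.
Qed.

Canonical square_det := Group square_det_group_set.

(** The matrices of square determinant form a group that contains the scalars
and is stable under conjugation, so its image in PGL(2, F) contains the class of
M; if that class generates, every invertible matrix has a square determinant,
including diag(a, 1). *)
Lemma all_square_of_generation M s :
  \det (GLval M) = s ^+ 2 -> PGL2 F \subset <<pi M ^: PGL2 F>>%g ->
  forall a, exists t, a = t ^+ 2.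
Proof.
move=> sM genM a; have [->|nza] := eqVneq a 0; first by exists 0; rewrite expr0n.
suff GsubK : 'GL_2[F] \subset square_det.
  have [N NE] : exists N : {'GL_2[F]}, GLval N = mx2 a 0 0 1.
    by apply: GL2_of_det; rewrite det_mx2 !mxE /= mulr0 subr0 mulr1.
  have := subsetP GsubK N; rewrite !inE NE det_mx2 !mxE /= mulr0 subr0 mulr1.
  by case/(_ isT)/existsP=> t /eqP; exists t.
have sZK : scalarGL2 F \subset square_det.
  apply/subsetP=> N; rewrite !inE => /is_scalar_mxP[b ->].
  by apply/existsP; exists b; rewrite det_scalar.
rewrite -(quotientSGK (GL2_norm_scalar F) sZK) (subset_trans genM) // gen_subG.
apply/subsetP=> _ /imsetP[_ /morphimP[N _ _ ->] ->].
rewrite -morphJ ?mem_norm_scalar // mem_quotient // inE.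
apply/existsP; exists s; rewrite conjgE !GL_MxE GL_VxE.
by rewrite det_mulmx mulrC -det_mulmx mulmxK ?GL_unitmx // sM.
Qed.

End GL2.

(** * Squares in a finite field of odd order *)

Section Squares.

Variables (F : finFieldType) (n : nat).
Hypothesis cardF : #|F| = n.*2.+1.
Implicit Types x y : F.
Local Open Scope ring_scope.

Lemma half_gt0 : (0 < n)%N.
Proof. by have := finNzRing_gt1 F; rewrite cardF; case: n. Qed.

Lemma expf_pred_card x : x != 0 -> x ^+ n.*2 = 1.
Proof.
by move=> nzx; apply: (mulfI nzx); rewrite -exprS -cardF expf_card mulr1.
Qed.

Lemma has_generator : exists z : F, n.*2.-primitive_root z.
Proof.
have: has n.*2.-primitive_root (enum (predC1 (0 : F))).
  apply: has_prim_root.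
  - by rewrite double_gt0 half_gt0.
  - by apply/allP=> x; rewrite mem_enum unity_rootE => /expf_pred_card->.
  - exact: enum_uniq.
  - by rewrite -cardE cardC1 cardF.
by case/hasP=> z _; exists z.
Qed.

(** With z a generator of the multiplicative group and x = z ^ i, both sides say
that i is even. *)
Lemma euler_criterion x : x != 0 -> (exists y, x = y ^+ 2) <-> x ^+ n = 1.
Proof.
move=> nzx; split=> [[y xy] | xn1].
  rewrite xy -exprM mul2n expf_pred_card //.
  by apply: contraNneq nzx => y0; rewrite xy y0 expr0n.
have [z prim_z] := has_generator.
have [i xi] := prim_rootP prim_z (expf_pred_card nzx).
move/eqP: xn1; rewrite xi -exprM -(prim_order_dvd prim_z) -[X in (X %| _)%N]mul2n.
rewrite dvdn_pmul2r ?half_gt0 // => /dvdnP[j ij].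
by exists (z ^+ j); rewrite ij exprM.
Qed.

(** The n-th power of a generator is a square root of 1 other than 1. *)
Lemma oner_neqN1 : 1 != -1 :> F.
Proof.
have [z prim_z] := has_generator.
have zn1 : z ^+ n != 1.
  rewrite -(prim_order_dvd prim_z) gtnNdvd ?half_gt0 //.
  by rewrite -addnn -ltn_subLR // subnn half_gt0.
have: (z ^+ n) ^+ 2 == 1 by rewrite -exprM muln2 prim_expr_order.
by rewrite sqrf_eq1 (negPf zn1) /=; apply: contraTneq => <-.
Qed.

Lemma expf_half x : x != 0 -> x ^+ n = 1 \/ x ^+ n = -1.
Proof.
move=> /expf_pred_card; rewrite -muln2 exprM => /eqP.
by rewrite sqrf_eq1 => /orP[]/eqP; [left | right].
Qed.

Lemma mul_nonsquares x y :
  nonsquare x -> nonsquare y -> exists t, x * y = t ^+ 2.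
Proof.
have halfN1 (u : F) : nonsquare u -> u != 0 /\ u ^+ n = -1.
  move=> ns_u; have nzu : u != 0.
    by apply/eqP=> u0; case: (ns_u 0); rewrite expr0n u0.
  by case: (expf_half nzu) => // /(euler_criterion nzu)[t /esym/ns_u].
move=> /halfN1[nzx xn] /halfN1[nzy yn]; apply/euler_criterion.
  by rewrite mulf_neq0.
by rewrite exprMn xn yn mulrNN mulr1.
Qed.

Lemma N1_square : (exists t : F, -1 = t ^+ 2) <-> ~~ odd n.
Proof.
rewrite euler_criterion ?oppr_eq0 ?oner_eq0 // -signr_odd.
case: (odd n); split=> //; rewrite expr1 => /esym/eqP.
by rewrite (negPf oner_neqN1).
Qed.

Lemma exists_nonsquare : exists x : F, nonsquare x.
Proof.
have [z prim_z] := has_generator; exists z => t zt.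
have nzt : t != 0.
  apply/eqP => t0; have := prim_root_eq0 prim_z.
  by rewrite -zt t0 expr0n eqxx double_eq0 eqn0Ngt half_gt0.
have : z ^+ n == 1 by rewrite -zt -exprM mul2n expf_pred_card.
rewrite -(prim_order_dvd prim_z) gtnNdvd ?half_gt0 //.
by rewrite -addnn -ltn_subLR // subnn half_gt0.
Qed.

Lemma card_sqrt x : x != 0 -> #|[set a : F | a ^+ 2 == x ^+ 2]| = 2.
Proof.
move=> nzx; have -> : [set a : F | a ^+ 2 == x ^+ 2] = [set x; -x].
  by apply/setP=> a; rewrite !inE eqf_sqr.
suff nexN : x != - x by rewrite cards2 nexN.
apply: contraNneq oner_neqN1 => xN.
by apply/eqP/(mulfI nzx); rewrite mulrN mulr1.
Qed.

End Squares.

(** * Classes of traceless matrices *)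

Section TracelessClasses.

Variables (F : finFieldType) (n : nat).
Hypothesis cardF : #|F| = n.*2.+1.
Implicit Types (M N : {'GL_2[F]}) (a D : F).
Local Open Scope ring_scope.
Local Notation pi := (coset (scalarGL2 F)).

(** The sign makes a matrix [a, b; c, - a] belong to [traceless D] exactly when
a^2 + bc = D. *)
Definition traceless D : {set {'GL_2[F]}} :=
  [set M | (\tr (GLval M) == 0) && (\det (GLval M) == - D)].

Lemma traceless_nonscalar M : \tr (GLval M) = 0 -> ~~ is_scalar_mx (GLval M).
Proof.
rewrite tr_mx2 => /eqP; rewrite addr_eq0 => /eqP trM.
apply/negP => /scalar_mx2P[M01 _ M00]; have nzd : \det (GLval M) != 0 := GL_det M.
have nz00 : GLval M 0 0 != 0.
  by apply: contraNneq nzd => M00_0; rewrite det_mx2 M01 M00_0 !mul0r subr0.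
have /eqP := oner_neqN1 cardF; apply; apply: (mulIf nz00).
by rewrite mul1r mulN1r {1}trM M00.
Qed.

Lemma traceless_class M D : M \in traceless D ->
  (pi M ^: PGL2 F)%g = pi @: traceless D.
Proof.
rewrite inE => /andP[/eqP trM /eqP detM]; apply/setP=> g; apply/idP/imsetP.
  case/imsetP=> _ /morphimP[P _ _ ->] ->; exists (M ^ P)%g; last first.
    by rewrite -morphJ ?mem_norm_scalar.
  rewrite inE conjgE !GL_MxE GL_VxE mxtrace_mulC mulmxK ?GL_unitmx // trM eqxx.
  by rewrite det_mulmx mulrC -det_mulmx mulmxK ?GL_unitmx // detM eqxx.
case=> N; rewrite inE => /andP[/eqP trN /eqP detN] ->.
apply: (@PGL2_conj F 1); rewrite ?oner_neq0 ?traceless_nonscalar //.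
  by rewrite trN trM mulr0.
by rewrite detN detM expr1n mul1r.
Qed.

(** The map to PGL(2, F) has fibres of the form {M, - M}: among the multiples
a M only those with a^2 = 1 have the determinant of M. *)
Lemma card_traceless_coset D : (#|pi @: traceless D|).*2 = #|traceless D|.
Proof.
rewrite -[RHS]sum1_card (partition_big pi [in pi @: traceless D]); last first.
  by move=> M DM; apply: imset_f.
rewrite -muln2 -sum_nat_const; apply: eq_bigr => _ /imsetP[M DM ->].
have nzd : \det (GLval M) != 0 := GL_det M.
have N1_nz : -1 != 0 :> F by rewrite oppr_eq0 oner_eq0.
have [N NM] := scaleGL2 M N1_nz.
have MneN : M != N.
  apply: contraNneq nzd => MN; move/eqP: NM.
  rewrite -MN -subr_eq0 -{1}[GLval M]scale1r -scalerBl scaler_eq0 subr_eq0.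
  by rewrite (negPf (oner_neqN1 cardF)) /= => /eqP->; rewrite det0.
rewrite sum1dep_card (_ : [set _ | _] = [set M; N]) ?cards2 ?MneN //.
move: DM; rewrite inE => /andP[/eqP trM /eqP detM].
apply/setP=> P; rewrite !inE; apply/andP/orP; last first.
  case=> /eqP->; first by rewrite trM detM !eqxx.
  rewrite NM mxtraceZ trM mulr0 detZ sqrrN expr1n mul1r detM !eqxx; split=> //.
  by apply/coset_eqP; exists (-1).
case=> /andP[_ /eqP detP] /coset_eqP[a _ PaM].
have := detP; rewrite PaM detZ -detM -{2}[\det _]mul1r => /(mulIf nzd)/eqP.
rewrite sqrf_eq1 => /orP[]/eqP a1; [left|right]; apply/eqP/val_inj.
  by rewrite [LHS]PaM a1 scale1r.
by rewrite [LHS]PaM a1 [RHS]NM.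
Qed.

(** The equation a^2 + bc = D is solved by choosing a and c != 0 freely, which
determines b (the map g below), or by c = 0, a a square root of D and b
arbitrary (the map h). *)
Lemma card_traceless D : D != 0 ->
  #|traceless D| = (#|F| * #|F|.-1 + #|[set a : F | a ^+ 2 == D]| * #|F|)%N.
Proof.
move=> nzD.
pose f M := (GLval M 0 0, GLval M 0 1, GLval M 1 0).
have f_inj : {in traceless D &, injective f}.
  move=> M N; rewrite !inE !tr_mx2 => /andP[+ _] /andP[+ _] [E00 E01 E10].
  rewrite !addr_eq0 E00 => /eqP EM /eqP EN; apply: val_inj; apply: eq_mx2 => //.
  by apply: oppr_inj; rewrite -EM -EN.
rewrite -(card_in_imset f_inj).
pose g (u : F * F) := (u.1, (D - u.1 ^+ 2) / u.2, u.2).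
pose h (u : F * F) := (u.1, u.2, 0 : F).
have -> : f @: traceless D = g @: setX setT [set~ 0]
    :|: h @: setX [set a | a ^+ 2 == D] setT.
  apply/setP=> -[[a b] c]; rewrite inE; apply/imsetP/orP.
  - case=> M; rewrite inE tr_mx2 det_mx2 => /andP[/eqP trM /eqP detM] [-> -> ->].
    have M11 : GLval M 1 1 = - GLval M 0 0.
      by apply/eqP; rewrite -addr_eq0 addrC trM.
    have DE : D - GLval M 0 0 ^+ 2 = GLval M 0 1 * GLval M 1 0.
      by rewrite -(opprK D) -detM M11; ring.
    have [M10|nz10] := eqVneq (GLval M 1 0) 0; [right | left]; apply/imsetP.
      exists (GLval M 0 0, GLval M 0 1); rewrite ?inE /h /= ?M10 // andbT.
      by rewrite eq_sym -subr_eq0 DE M10 mulr0.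
    exists (GLval M 0 0, GLval M 1 0); rewrite ?inE //.
    by rewrite /g /= DE mulfK.
  - suff fM : a ^+ 2 + b * c = D -> exists2 M, M \in traceless D & (a, b, c) = f M.
      case=> /imsetP[[x y]]; rewrite !inE /= ?andbT => Hxy [aE bE cE]; apply: fM.
        by rewrite aE bE cE divfK // addrC subrK.
      by rewrite aE cE mulr0 addr0; apply/eqP.
    move=> abcD; have [M ME] : exists M, GLval M = mx2 a b c (- a).
      apply: GL2_of_det; rewrite det_mx2 !mxE /= (_ : _ - _ = - D) ?oppr_eq0 //.
      by rewrite -abcD; ring.
    exists M; last by rewrite /f ME !mxE.
    by rewrite inE ME tr_mx2 det_mx2 !mxE /= subrr eqxx -abcD; apply/eqP; ring.
rewrite cardsU disjoint_setI0 ?cards0 ?subn0; last first.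
  rewrite disjoint_subset; apply/subsetP=> _ /imsetP[[a c] + ->].
  rewrite !inE /= => nzc; apply/imsetP=> -[[x y] _ [_ _ c0]].
  by rewrite c0 eqxx in nzc.
rewrite !card_imset => [|[a b] [c d] [-> ->] //|[a b] [c d] [-> _ ->] //].
by rewrite !cardsX !cardsT cardsC1.
Qed.

End TracelessClasses.

(** * Primitive quandles over PGL(2, q) *)

Local Close Scope group_scope.

Theorem theorem4p8 (p k q : nat) (p_prime : prime p) (p_odd : odd p)
    (q_def : q = p ^ k) (q_gt3 : 3 < q)
    (F : finFieldType) (F_card : #|F| = q)
    (X : quandle) (X_prim : primitive_quandle X)
    (X_Inn : isog_perm (PGL2 F) (@Inn X)) :
  [/\ q = 1 %[mod 4], has_card X ((q * (q - 1)) %/ 2)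
    & forall (Delta : F) (nsD : nonsquare Delta), quandle_iso X (Conj_C6 nsD)]
  \/
  [/\ q = 3 %[mod 4], has_card X ((q * (q + 1)) %/ 2)
    & quandle_iso X (Conj_C4 F)].
Proof.
have [n qE] : exists n, q = n.*2.+1.
  by exists q./2; rewrite -[LHS]odd_double_half q_def oddX p_odd orbT.
rewrite qE in F_card *; clear q_def q_gt3 qE q.
have [_ /morphimP[M _ _ ->] /= [cardX genM realM isoX]] :=
  primitive_quandle_conj X_prim X_Inn (PGL2_nonabelian F).
have trM : (\tr (GLval M) = 0)%R.
  apply: tr_of_involution (realM (PGL2_real M)) _.
  apply: contraNneq (PGL2_nonabelian F) => M1; move: genM.
  by rewrite M1 class1G gen_set_id ?groupP // => /abelianS; apply; apply: abelian1.
pose D : F := (- \det (GLval M))%R.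
have nzd : (\det (GLval M) != 0)%R := GL_det M.
have nzD : (D != 0)%R by rewrite oppr_eq0.
have DM : M \in traceless D by rewrite inE trM eqxx opprK eqxx.
have nsdet : nonsquare (\det (GLval M))%R.
  move=> s /esym sM; have [x ns_x] := exists_nonsquare F_card.
  by have [t /esym/ns_x] := all_square_of_generation sM genM x.
have classE := traceless_class F_card DM.
have cardC : #|(coset (scalarGL2 F) M ^: PGL2 F)%g|.*2
    = n.*2.+1 * n.*2 + #|[set a : F | a ^+ 2 == D]%R| * n.*2.+1.
  by rewrite classE (card_traceless_coset F_card) card_traceless // F_card.
have card_half m :
    m = #|(coset (scalarGL2 F) M ^: PGL2 F)%g|.*2 -> has_card X (m %/ 2).
  by move=> ->; rewrite divn2 doubleK.
have [odd_n|even_n] := boolP (odd n); [right | left].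
(* Here -1 and det M are nonsquares, so D = s^2, and M / s has determinant -1. *)
- have [s Ds] : exists s, D = (s ^+ 2)%R.
    rewrite /D -mulN1r; apply: (mul_nonsquares F_card) => //.
    move=> t /esym tN1.
    by have /(N1_square F_card)/negP[] : exists u : F, (-1 = u ^+ 2)%R by exists t.
  have nzs : s != 0%R by apply: contraNneq nzD => s0; rewrite Ds s0 expr0n.
  split.
  + rewrite -[n]odd_double_half odd_n; lia.
  + apply: card_half; rewrite cardC Ds (card_sqrt F_card nzs); lia.
  apply: isoX; apply: (@PGL2_conj F s^-1%R).
  + by rewrite invr_eq0.
  + exact: traceless_nonscalar F_card _ trM.
  + apply/negP => /scalar_mx2P[_ _]; rewrite !mxE /= => /esym/eqP.
    exact/negP/(oner_neqN1 F_card).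
  + by rewrite trM mulr0 tr_mx2 !mxE /= addNr.
  + rewrite det_mx2 !mxE /= exprVn -Ds /D; field; rewrite oppr_eq0; exact: nzd.
(* Here -1 is a square, so D is a nonsquare. The product of two nonsquares is a
   square, Delta D = t^2, and then (t / D) M has determinant - Delta. *)
- have [i iN1] := (N1_square F_card).2 even_n.
  have nsD : nonsquare D.
    move=> s /esym sD; apply: (nsdet (i * s)%R).
    by rewrite exprMn -iN1 -sD /D mulN1r opprK.
  split.
  + rewrite -[n]odd_double_half (negPf even_n); lia.
  + apply: card_half; rewrite cardC (_ : [set _ | _] = set0) ?cards0; first lia.
    by apply/setP=> a; rewrite !inE; apply/eqP/nsD.
  move=> Delta nsDelta; have [t tE] := mul_nonsquares F_card nsDelta nsD.
  have nzDelta : (Delta != 0)%R.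
    by apply/eqP => D0; case: (nsDelta 0%R); rewrite D0 expr0n.
  have nzt : (t != 0)%R.
    apply/eqP => t0; have := mulf_neq0 nzDelta nzD.
    by rewrite tE t0 expr0n eqxx.
  apply: isoX; apply: (@PGL2_conj F (t / D)%R).
  + by rewrite mulf_neq0 ?invr_eq0.
  + exact: traceless_nonscalar F_card _ trM.
  + by apply/negP => /scalar_mx2P[_]; rewrite !mxE /= => /eqP; rewrite oner_eq0.
  + by rewrite trM mulr0 tr_mx2 !mxE /= addr0.
  + rewrite exprMn exprVn -tE -(opprK (\det (GLval M))%R) -/D det_mx2 !mxE /=.
    by field.
Qed.
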